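(* Let $G$ be a finite nilpotent group. If $G$ is a filled group, then $G$ is either a $2$-group or isomorphic to $C_3$ or $C_5$.
   Context: $C_n$ denotes the cyclic group of order $n$. For subsets $S,V$ of a group $G$, $SV=\{sv : s\in S, v\in V\}$. A non-empty subset $S$ of a finite group $G$ is product-free if $S\cap SS=\varnothing$. A product-free set $S$ is locally maximal if whenever $T$ is a product-free subset of $G$ with $S\subseteq T$, then $S=T$. $G^*$ denotes the set of non-identity elements of $G$. A subset $S$ of $G$ fills $G$ if $G^*\subseteq S\cup SS$. $G$ is a filled group if every locally maximal product-free set in $G$ fills $G$. The trivial group counts as a $2$-group. *)

(* Defs.v *)
From mathcomp Require Import all_boot all_fingroup all_solvable.

Set Implicit Arguments.
Unset Strict Implicit.
Unset Printing Implicit Defensive.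

Local Open Scope group_scope.

Section FilledGroups.

Variable gT : finGroupType.
Implicit Types (S : {set gT}) (G : {group gT}).

Definition product_free S : bool := (S != set0) && (S :&: S * S == set0).

Definition locally_maximal G S : bool :=
  maxset (fun T : {set gT} => (T \subset G) && product_free T) S.

Definition fills S G : bool := G^# \subset S :|: S * S.

Definition filled G : bool :=
  [forall S : {set gT}, locally_maximal G S ==> fills S G].

End FilledGroups.

(* Main.v *)
Require Import Defs.
From mathcomp Require Import all_boot all_fingroup all_solvable all_algebra.
From mathcomp Require Import zify.

Local Open Scope group_scope.

(* The preimage of a locally maximal set under a surjective morphism is locally
   maximal, so every quotient of G is filled. The cyclic group of order n, for
   n > 5 and n <> 8, is not filled, as the middle third of Z/n shows, and
   Z/5 x Z/5 is not filled either. The coset of an element outside a normal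
   subgroup N of index 3 is locally maximal and its square avoids N, so N must
   be trivial. If an odd prime p divides the order of the nilpotent group G, its
   Sylow p-subgroup is a quotient of G, hence has order 3 or 5. In the first
   case G itself has order 3; in the second one a further prime q would give a
   cyclic quotient of order 5q. *)

(** * Product-free and locally maximal sets *)

Lemma product_freeP (gT : finGroupType) (S : {set gT}) :
  reflect (S != set0 /\ {in S &, forall x y, x * y \notin S}) (product_free S).
Proof.
apply: (iffP andP) => [[nzS /eqP SSS] | [nzS SSS]]; split=> //.
  move=> x y Sx Sy; apply/negP=> Sxy.
  suff: x * y \in S :&: S * S by rewrite SSS inE.
  by rewrite inE Sxy mem_mulg.
apply/eqP/setP=> z; rewrite !inE; apply/andP=> -[Sz /mulsgP[x y Sx Sy Dz]].
by have /negP[] := SSS x y Sx Sy; rewrite -Dz.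
Qed.

(** The four alternatives are the only obstructions to adjoining [g] to [S]: either [g] lies in [S]
    already, or [g], [g * g] or a product of [g] with an element of [S] breaks product-freeness. *)
Lemma locally_maximalP (gT : finGroupType) (G : {group gT}) (S : {set gT}) :
  reflect [/\ S \subset G, product_free S
    & {in G, forall g, [|| g \in S, g \in S * S, g * g \in S |
                        [exists s in S, (g * s \in S) || (s * g \in S)]]}]
    (locally_maximal G S).
Proof.
apply: (iffP maxsetP) => [[/andP[sSG freeS] maxS] | [sSG freeS covS]].
  split=> // g Gg; apply: contraT; rewrite !negb_or => /and4P[S'g SS'g S'gg S'gs].
  have [/set0Pn[s0 Ss0] fS] := product_freeP _ _ freeS.
  have{} S'gs s : s \in S -> (g * s \notin S) /\ (s * g \notin S).
    move=> Ss; apply/andP; rewrite -negb_or; apply: contra S'gs => Sgs.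
    by apply/exists_inP; exists s.
  (* These two facts exclude the degenerate coincidences [g * g = g], [g * s = g] and
     [s * g = g]. *)
  have ng1: g != 1.
    by apply/negP=> /eqP g1; have [] := S'gs s0 Ss0; rewrite g1 mul1g Ss0.
  have S'1: 1 \notin S by apply/negP=> S1; have := fS 1 1 S1 S1; rewrite mulg1 S1.
  suff free_gS: (g |: S \subset G) && product_free (g |: S).
    by case/negP: S'g; rewrite -(maxS _ free_gS (subsetUr _ _)) setU11.
  rewrite subUset sub1set Gg sSG; apply/product_freeP; split.
    by apply/set0Pn; exists g; rewrite setU11.
  move=> x y; rewrite !inE => /predU1P[-> | Sx] /predU1P[-> | Sy].
  - by rewrite negb_or S'gg -{3}[g]mulg1 (inj_eq (mulgI g)) ng1.
  - rewrite negb_or (S'gs y Sy).1 andbT -{2}[g]mulg1 (inj_eq (mulgI g)).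
    by apply: contraNneq S'1 => <-.
  - rewrite negb_or (S'gs x Sx).2 andbT -{2}[g]mul1g (inj_eq (mulIg g)).
    by apply: contraNneq S'1 => <-.
  - rewrite negb_or fS // andbT.
    by apply: contraNneq SS'g => <-; apply: mem_mulg.
split=> [|T /andP[sTG /product_freeP[_ fT]] sST]; first by rewrite sSG.
apply/eqP; rewrite eqEsubset sST andbT; apply/subsetP=> t Tt.
have sT := subsetP sST.
case/or4P: (covS t (subsetP sTG t Tt)) => // [/mulsgP[x y Sx Sy Dt] | Stt |].
- by have := fT x y (sT x Sx) (sT y Sy); rewrite -Dt Tt.
- by have := fT t t Tt Tt; rewrite sT.
case/exists_inP=> s Ss /orP[] /sT; apply: contraTT => _; apply: fT => //; exact: sT.
Qed.

(** * Images, quotients and normal subgroups of index 3 *)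

(* The elements of the kernel are blocked by [g * s \in S]. *)
Lemma locally_maximal_morphpre (gT rT : finGroupType) (G : {group gT})
    (f : {morphism G >-> rT}) (S : {set rT}) :
  locally_maximal (f @* G)%G S -> locally_maximal G (f @*^-1 S).
Proof.
case/locally_maximalP=> sSG freeS covS.
have [/set0Pn[s0 Ss0] fS] := product_freeP _ _ freeS.
have im_f s: s \in S -> exists2 x, x \in f @*^-1 S & s = f x.
  move=> Ss; have /morphimP[x Gx _ Ds] := subsetP sSG s Ss.
  by exists x => //; rewrite !inE Gx /= -Ds.
apply/locally_maximalP; split; first exact: subsetIl.
  apply/product_freeP; split.
    by have [x Sx _] := im_f s0 Ss0; apply/set0Pn; exists x.
  move=> x y /morphpreP[Gx Sfx] /morphpreP[Gy Sfy].
  by rewrite !inE groupM //= morphM // fS.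
move=> g Gg; case/or4P: (covS (f g) (mem_morphim f Gg Gg)) => [Sg|Sg|Sg|].
- by rewrite !inE Gg /= Sg.
- by apply/or4P/Or42; rewrite -morphpreMl //; apply/morphpreP.
- by apply/or4P/Or43/morphpreP; rewrite groupM // morphM.
case/exists_inP=> s /im_f[x Sx ->] Sgx; apply/or4P/Or44/exists_inP; exists x => //.
have [Gx _] := morphpreP Sx.
by rewrite -!morphM // in Sgx; rewrite !inE !groupM.
Qed.

(** Only [x], not [f x], has to be non-trivial: for [x] in the kernel this puts the identity into
    [S :|: S * S], which filledness of the image alone does not give. *)
Lemma fills_morphpre (gT rT : finGroupType) (G : {group gT})
    (f : {morphism G >-> rT}) (S : {set rT}) (x : gT) :
    filled G -> locally_maximal (f @* G)%G S -> x \in G^# ->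
  f x \in S :|: S * S.
Proof.
move=> /forallP/(_ (f @*^-1 S))/implyP fillG maxS Gx.
have [sSG _ _] := locally_maximalP _ _ _ maxS.
have /subsetP/(_ x Gx) := fillG (locally_maximal_morphpre _ _ _ f S maxS).
by rewrite -morphpreMl // => /setUP[] /morphpreP[_ Sx]; rewrite inE Sx ?orbT.
Qed.

Lemma filled_morphim (gT rT : finGroupType) (G : {group gT})
    (f : {morphism G >-> rT}) :
  filled G -> filled (f @* G)%G.
Proof.
move=> fillG; apply/forallP=> S; apply/implyP=> maxS.
apply/subsetP=> y /setD1P[ny1 /morphimP[x Gx _ Dy]].
rewrite Dy; apply: fills_morphpre => //; rewrite !inE Gx andbT.
by apply: contraNneq ny1 => x1; rewrite Dy x1 morph1.
Qed.

Lemma filled_quotient (gT : finGroupType) (G N : {group gT}) :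
  N <| G -> filled G -> filled (G / N)%G.
Proof.
move=> nsNG fG.
have nNG := normal_norm nsNG.
have := filled_morphim _ _ _ (restrm_morphism nNG (coset_morphism N)) fG.
by congr filled; apply/val_inj; rewrite /= morphim_restrm setIid.
Qed.

Lemma isog_filled (gT rT : finGroupType) (G : {group gT}) (H : {group rT}) :
  G \isog H -> filled G -> filled H.
Proof.
case/isogP=> f _ defH fG; have := filled_morphim _ _ _ f fG.
by congr filled; apply/val_inj.
Qed.

Lemma filled_index3 (gT : finGroupType) (G N : {group gT}) :
  N <| G -> #|G : N| = 3 -> filled G -> #|G| = 3.
Proof.
move=> nsNG iNG fillG; have [sNG nNG] := andP nsNG.
have oGN: #|G / N| = 3 by rewrite card_quotient.
have /cyclicP[x defGN]: cyclic (G / N) by apply: prime_cyclic; rewrite oGN.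
have ox: #[x] = 3 by rewrite orderE -defGN.
have x3: x ^+ 3 = 1 by rewrite -ox expg_order.
have nx1: x != 1 by rewrite -order_eq1 ox.
have maxx: locally_maximal (G / N)%G [set x].
  apply/locally_maximalP; split; first by rewrite /= defGN sub1set cycle_id.
    apply/product_freeP; split; first by apply/set0Pn; exists x; rewrite set11.
    by move=> y z /set1P-> /set1P->; rewrite inE -{3}[x]mulg1 (inj_eq (mulgI x)).
  move=> y; rewrite /= defGN => /cyclePmin[[|[|[|i]]]]; rewrite ox // => _ ->.
  - by apply/or4P/Or44/exists_inP; exists x; rewrite ?mul1g !inE ?eqxx.
  - by rewrite inE eqxx.
  - by apply/or4P/Or42; apply: mem_mulg; rewrite inE.
suff N1: N :=: 1 by have := Lagrange sNG; rewrite iNG N1 cards1 mul1n.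
(* A non-trivial [y] in [N] maps to the identity, which is neither [x] nor [x * x] as [x] has order
   3. *)
apply/trivgP/subsetP=> y Ny; apply/set1P/eqP; apply: contraT => ny1.
have im_f: restrm nNG (coset_morphism N) @* G = G / N by rewrite morphim_restrm setIid.
have := fills_morphpre _ _ _ (restrm_morphism nNG (coset_morphism N)) [set x] y fillG.
rewrite /locally_maximal /= im_f => /(_ maxx).
rewrite !inE ny1 (subsetP sNG) //= /restrm /= coset_id // eq_sym (negPf nx1) /=.
move/(_ isT)=> /mulsgP[_ _ /set1P-> /set1P->] xx.
by move: nx1; rewrite -x3 expgS expgS expg1 -xx mulg1 eqxx.
Qed.

(** * Cyclic groups *)

(** Two residues add up to less than twice the modulus, so one subtraction replaces the remainder
    and leaves linear goals. *)
Lemma val_mul_Zp (m : nat) (x y : 'I_m.+2) :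
  (x * y : 'I_m.+2) = (if x + y < m.+2 then x + y else x + y - m.+2)%N :> nat.
Proof.
have := ltn_ord x; have := ltn_ord y; rewrite /=.
case: (ltnP (x + y) m.+2) => [lt_n | le_n lty ltx]; first by rewrite modn_small.
by rewrite -{1}(subnK le_n) modnDr modn_small //; lia.
Qed.

(* With k = n %/ 3, the interval [k, 2k - 1] is locally maximal, its sumset is
   [2k, 4k - 2], and neither of them contains k - 1 modulo n. *)
Lemma Zp_not_filled (n : nat) : 5 < n -> n != 8 -> ~~ filled (Zp n).
Proof.
case: n => [|[|m]] // n_gt5 n_neq8; set k := (m.+2 %/ 3)%N.
have [r Dn ltr3]: exists2 r, m.+2 = (k * 3 + r)%N & r < 3.
  by exists (m.+2 %% 3)%N; [exact: divn_eq | exact: ltn_mod].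
(* This makes the missed element [k - 1] different from the identity. *)
have k_gt1: 1 < k by clearbody k; lia.
pose S := [set x : 'I_m.+2 | (k <= x < 2 * k)%N].
have SP (x : 'I_m.+2): reflect (k <= x < 2 * k)%N (x \in S).
  by rewrite inE; apply: idP.
have lt_k: k < m.+2 by lia.
have Sk: Ordinal lt_k \in S by apply/SP => /=; lia.
have freeS (x y : 'I_m.+2): x \in S -> y \in S -> x * y \notin S.
  by move=> /SP Sx /SP Sy; apply/SP; rewrite val_mul_Zp; case: ifP; lia.
have lowS (g : 'I_m.+2): g < k -> g * Ordinal lt_k \in S.
  by move=> lt_gk; apply/SP; rewrite val_mul_Zp /=; case: ifP; lia.
have highS (g : 'I_m.+2): 2 * k <= g -> g \in S * S.
  (* Both [a] and [g - a] must lie in [[k, 2k - 1]], so [a] is taken as large as possible. Order 8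
     fails here: then [k = 2], and 7 is not a sum of two elements of [{2, 3}]. *)
  move=> le_kg; have lt_g := ltn_ord g; set a := minn (2 * k - 1) (g - k).
  have lt_a: a < m.+2 by lia.
  have lt_b: g - a < m.+2 by lia.
  apply/mulsgP; exists (Ordinal lt_a) (Ordinal lt_b).
  - by apply/SP => /=; lia.
  - by apply/SP => /=; lia.
  by apply/val_inj; rewrite [RHS]val_mul_Zp /=; case: ifP; lia.
have missS (x y : 'I_m.+2): x \in S -> y \in S -> (k - 1)%N != (x * y : 'I_m.+2).
  by move=> /SP Sx /SP Sy; rewrite val_mul_Zp; case: ifP; lia.
have maxS: locally_maximal (Zp m.+2) S.
  apply/locally_maximalP; split; first exact: subsetT.
    by apply/product_freeP; split=> //; apply/set0Pn; exists (Ordinal lt_k).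
  move=> g _; case: (ltnP g k) => [/lowS Sgk | le_kg].
    by apply/or4P/Or44/exists_inP; exists (Ordinal lt_k); rewrite ?Sgk.
  case: (ltnP g (2 * k)) => [lt_gk | /highS SSg]; last exact/or4P/Or42.
  by apply/or4P/Or41/SP; rewrite le_kg.
have lt_k1: (k - 1 < m.+2)%N by lia.
apply/negP=> /forallP/(_ S); rewrite maxS => /subsetP/(_ (Ordinal lt_k1)).
rewrite !inE -val_eqE /= -/k => /(_ _)/orP[||/mulsgP[x y Sx Sy Dxy]]; try lia.
by case/eqP: (missS x y Sx Sy); rewrite -Dxy.
Qed.

Lemma cyclic_filled (gT : finGroupType) (G : {group gT}) :
  cyclic G -> filled G -> (#|G| <= 5) || (#|G| == 8).
Proof.
case/cyclicP=> x defG fG; rewrite defG -orderE; apply: contraT.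
rewrite negb_or -ltnNge => /andP[x_gt5 x_neq8].
have := Zp_not_filled _ x_gt5 x_neq8; rewrite (isog_filled _ _ G) //.
by rewrite defG isog_sym Zp_isog.
Qed.

(** * The elementary abelian group of order 25 *)

Lemma Z5xZ5_not_filled : ~~ filled [set: 'Z_5 * 'Z_5]%G.
Proof.
pose u (ij : nat * nat) : 'Z_5 * 'Z_5 := (inZp ij.1, inZp ij.2).
(* An explicit witness, whose sumset misses [(3, 0)]. The lists [L] and [R], the latter of all 25
   elements, turn each condition into a computation. *)
pose L := [seq u ij | ij <- [:: (0, 1); (0, 4); (1, 0); (2, 1); (2, 4)]%N].
pose R := [seq u (i, j) | i <- iota 0 5, j <- iota 0 5].
have allR g: g \in R.
  case: g => i j; apply/allpairsP; exists (i : nat, j : nat).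
  by rewrite !mem_iota !ltn_ord /u /= !valZpK.
have freeL: all (fun x => all (fun y => x * y \notin L) L) L by vm_compute.
have covL: all (fun g => [|| g \in L, has (fun x => has (fun y => g == x * y) L) L,
                             g * g \in L | has (fun s => g * s \in L) L]) R.
  by vm_compute.
have missL: ~~ has (fun x => has (fun y => u (3, 0)%N == x * y) L) L by vm_compute.
pose S := [set x in L].
have inS x: (x \in S) = (x \in L) by rewrite in_set.
have maxS: locally_maximal [set: 'Z_5 * 'Z_5]%G S.
  apply/locally_maximalP; split; first exact: subsetT.
    apply/product_freeP; split.
      by apply/set0Pn; exists (u (0, 1)%N); rewrite inS mem_head.
    by move=> x y; rewrite !inS => Lx Ly; apply: (allP (allP freeL x Lx) y Ly).
  move=> g _; case/or4P: (allP covL g (allR g)) => [Lg | | Lgg | ].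
  - by rewrite inS Lg.
  - case/hasP=> x Lx /hasP[y Ly /eqP->].
    by apply/or4P/Or42; apply: mem_mulg; rewrite inS.
  - by apply/or4P/Or43; rewrite inS.
  by case/hasP=> s Ls Lgs; apply/or4P/Or44/exists_inP; exists s; rewrite !inS // Lgs.
apply/negP=> /forallP/(_ S); rewrite maxS => /subsetP/(_ (u (3, 0)%N)).
case/(_ _)/setUP; [by rewrite !inE | by rewrite inS |].
case/mulsgP=> x y; rewrite !inS => Lx Ly Dxy; case/negP: missL.
by apply/hasP; exists x => //; apply/hasP; exists y => //; apply/eqP.
Qed.

Lemma abelem25_not_filled (gT : finGroupType) (E : {group gT}) :
  5.-abelem E -> #|E| = 25 -> ~~ filled E.
Proof.
move=> abelE oE; apply: contra Z5xZ5_not_filled; apply: isog_filled.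
rewrite (isog_abelem_card _ abelE) oE cardsT card_prod !card_ord eqxx andbT.
apply/abelemP => //; split.
  by apply/centsP=> -[a b] _ [c d] _; congr pair; apply: Zp_mulgC.
by case=> [[[|[|[|[|[|i]]]]] lti] [[|[|[|[|[|j]]]]] ltj]] // _; apply/eqP.
Qed.

(** * Direct factors, p-groups and nilpotent groups *)

(** The factor [A] is isomorphic to the quotient [G / B]. *)
Lemma filled_dprodl (gT : finGroupType) (A B G : {group gT}) :
  A \x B = G -> filled G -> filled A.
Proof.
move=> /dprodWsdC defG fG; have [nsBG _ _ _ _] := sdprod_context defG.
apply: isog_filled (filled_quotient _ _ _ nsBG fG).
by rewrite isog_sym (sdprod_isog defG).
Qed.

(** A quotient of order [p] forces [p] to be 3 or 5, and index 3 settles the first case. For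
    [p = 5], a non-cyclic group has a Frattini quotient of rank at least 2, hence a quotient that is
    elementary abelian of order 25. *)
Lemma filled_pgroup (gT : finGroupType) (p : nat) (P : {group gT}) :
  p.-group P -> P :!=: 1 -> odd p -> filled P -> #|P| = 3 \/ #|P| = 5.
Proof.
move=> pP ntP odd_p fP; have [p_pr _ [e oP]] := pgroup_pdiv pP ntP.
have [Q [_ nsQP oQ]] := normal_pgroup pP (normal_refl P) (leq_pred _).
have iQ: #|P : Q| = p.
  have := Lagrange (normal_sub nsQP); rewrite oQ oP pfactorK //= expnSr.
  by move/eqP; rewrite eqn_pmul2l ?expn_gt0 ?prime_gt0 // => /eqP.
have oPQ: #|P / Q| = p by rewrite card_quotient ?normal_norm.
have cycPQ: cyclic (P / Q) by rewrite prime_cyclic ?oPQ.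
have := cyclic_filled _ _ cycPQ (filled_quotient _ _ _ nsQP fP).
rewrite /= oPQ => le_p5; have [p3 | p5]: p = 3 \/ p = 5.
    by case: p p_pr odd_p le_p5 {pP oP iQ oPQ oQ} => [|[|[|[|[|[|[|[|[|p]]]]]]]]] //; auto.
  by left; apply: filled_index3 nsQP _ fP; rewrite iQ p3.
right; move: pP oP fP; rewrite {}p5 {iQ oPQ oQ le_p5 p_pr odd_p p} => pP oP fP.
have [cycP | ncycP] := boolP (cyclic P).
  have := cyclic_filled _ _ cycP fP; rewrite oP expnS.
  by case: e {oP} => // e; rewrite expnS; have: 0 < 5 ^ e by [rewrite expn_gt0]; lia.
have abelE := Phi_quotient_abelem pP; set E := P / _ in abelE.
have pE := abelem_pgroup abelE.
have: ~~ cyclic E by apply: contra ncycP; apply: Phi_quotient_cyclic.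
rewrite (abelem_cyclic abelE) -ltnNge => E_gt1.
(* [C] has index 25 in [E]. *)
have [C [_ nsCE oC]] := normal_pgroup pE (normal_refl _) (leq_subr 2 _).
suff /negP[]: ~~ filled (E / C)%G.
  by apply: filled_quotient => //; apply: filled_quotient => //; apply: Phi_normal.
apply: abelem25_not_filled; first exact: quotient_abelem.
rewrite /= card_quotient ?normal_norm // -divgS ?normal_sub // oC {1}(card_pgroup pE).
by rewrite -expnB ?leq_subr // subKn.
Qed.

(** The group is the direct product of its [p]-core and [p']-core, which are cyclic of coprime
    orders [p] and [q]. *)
Lemma cyclic_nilpotent_pq (gT : finGroupType) (p q : nat) (G : {group gT}) :
  nilpotent G -> prime p -> prime q -> p != q -> #|G| = (p * q)%N -> cyclic G.
Proof.
move=> nilG p_pr q_pr neq_pq oG.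
have defG := nilpotent_pcoreC p nilG.
have oP: #|'O_p(G)| = p.
  rewrite (card_Hall (nilpotent_pcore_Hall _ nilG)) oG partnM ?prime_gt0 //.
  by rewrite part_pnat_id ?pnat_id // part_p'nat ?muln1 // p'natE // dvdn_prime2.
have oK: #|'O_p^'(G)| = q.
  have := dprod_card defG; rewrite oP oG => /eqP.
  by rewrite eqn_pmul2l ?prime_gt0 // => /eqP.
rewrite (cyclic_dprod defG) ?prime_cyclic ?oP ?oK //.
by rewrite prime_coprime // dvdn_prime2.
Qed.

Theorem lemma2p7 (gT : finGroupType) (G : {group gT})
    (nilG : nilpotent G) (filledG : filled G) :
  [\/ 2.-group G, G \isog Zp 3 | G \isog Zp 5].
Proof.
suff: 2.-group G \/ (#|G| = 3 \/ #|G| = 5).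
  have isoG n: prime n -> #|G| = n -> G \isog Zp n.
    move=> n_pr oG; have /cyclicP[x defG]: cyclic G by rewrite prime_cyclic ?oG.
    by rewrite -oG defG -orderE isog_sym Zp_isog.
  by case=> [? | [] /isoG ?]; [apply: Or31 | apply: Or32; auto | apply: Or33; auto].
have [? | not2] := boolP (2.-group G); [by left | right].
rewrite /pgroup /pnat cardG_gt0 in not2; have{not2} [p] := allPn not2.
rewrite mem_primes inE => /and3P[p_pr _ p_G] p_neq2.
have odd_p: odd p by case: (even_prime p_pr) => // p2; rewrite p2 in p_neq2.
have defG := nilpotent_pcoreC p nilG.
have hallP := nilpotent_pcore_Hall p nilG.
have pP : p.-group 'O_p(G) := pcore_pgroup _ _.
have ntP: 'O_p(G) :!=: 1.
  rewrite -cardG_gt1 (card_Hall hallP) p_part.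
  rewrite -(exp1n (logn p #|G|)) ltn_exp2r ?prime_gt1 // logn_gt0.
  by rewrite mem_primes p_pr cardG_gt0.
have oG := dprod_card defG.
have [_ nsKG] := dprod_normal2 defG.
have iK: #|G : 'O_p^'(G)| = #|'O_p(G)|.
  by rewrite -divgS ?normal_sub // -oG mulnK.
have fP := filled_dprodl _ _ _ _ defG filledG.
have [oP | oP] := filled_pgroup _ _ _ pP ntP odd_p fP.
  by left; apply: filled_index3 nsKG _ filledG; rewrite iK.
right; rewrite oP in iK; clear fP.
have p5: p = 5.
  have [_ _ [e]] := pgroup_pdiv pP ntP; rewrite oP => p_5.
  by apply/eqP; rewrite -(dvdn_prime2 p_pr) // p_5 expnS dvdn_mulr.
rewrite p5 in defG pP oP oG nsKG iK {ntP p_pr p_G p_neq2 odd_p hallP}.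
have [K1 | ntK] := eqVneq ('O_5^'(G) : {set gT}) 1.
  by rewrite -oG oP K1 cards1.
(* The quotient of the [5']-core by a maximal normal subgroup [M] is simple and solvable, so its
   order is a prime [q]. *)
have [M maxM] := ex_maxnormal_ntrivg ntK.
have nsMK := maxnormal_normal maxM; have sMK := normal_sub nsMK.
have nilK := nilpotentS (normal_sub nsKG) nilG.
have q_pr: prime #|'O_5^'(G) / M|.
  by apply: simple_sol_prime; rewrite ?quotient_simple // quotient_sol ?nilpotent_sol.
set q := #|_ / M| in q_pr.
(* The [5']-core normalizes [M] and the [5]-core centralizes it; together they generate [G]. *)
have nsMG: M <| G.
  have [_ PK cPK _] := dprodP defG.
  apply/andP; split; first exact: subset_trans sMK (normal_sub nsKG).
  suff: 'O_5(G) * 'O_5^'(G) \subset 'N(M) by rewrite PK.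
  rewrite mul_subG ?(normal_norm nsMK) //.
  by rewrite cents_norm // centsC (subset_trans sMK).
have iM: #|G / M| = (5 * q)%N.
  by rewrite /q !card_quotient ?normal_norm // -(Lagrange_index (normal_sub nsKG) sMK) iK.
have neq5q: 5 != q.
  apply: contraTneq (pcore_pgroup 5^' G) => q5.
  by rewrite /pgroup p'natE // negbK {1}q5 dvdn_quotient.
have cycGM: cyclic (G / M).
  by apply: cyclic_nilpotent_pq iM; rewrite ?quotient_nil.
have := cyclic_filled _ _ cycGM (filled_quotient _ _ _ nsMG filledG).
(* Since [q] is at least 2, [5 * q] exceeds 5, and it is not 8. *)
rewrite /= iM; have := prime_gt1 q_pr; clearbody q; lia.
Qed.
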